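(* Let $(w_n)_{n\ge 1}$ be a sequence of integers with $w_n>1$ for all $n$, let $\Theta$ be the solenoid of type $\varpi=(w_1,w_2,\dots,w_n,\dots)$, and let $r\ge 1$ be an integer. Then there exists an $r$-fold covering $\pi:X\to\Theta$ with $X$ connected if and only if $r$ is relatively prime to $w_n$ for all but finitely many $n$.
   Context: Let $S^1=\{z\in\mathbb{C} : |z|=1\}$. Given a sequence of integers $\varpi=(w_1,w_2,\dots,w_n,\dots)$ with every $w_n>1$, let $\phi_n:S^1\to S^1$ be $\phi_n(x)=x^{w_n}$ for $n\ge 1$. The solenoid of type $\varpi$ is the inverse limit $$\Theta=\{(x_0,x_1,\dots,x_n,\dots) : x_n\in S^1 \text{ for } n\ge 0,\ x_{n-1}=\phi_n(x_n) \text{ for } n\ge 1\}\subset\prod_{n=0}^\infty S^1,$$ with the subspace topology of the product topology. (By convention the circle itself is not considered a solenoid; this is reflected in the requirement $w_n>1$.) An $r$-fold covering is a covering map all of whose fibers have exactly $r$ points. *)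

(* Defs.v *)
From mathcomp Require Import all_boot all_order all_algebra.
From mathcomp Require Import complex.
From mathcomp Require Import all_classical all_reals topology normedtype.

Set Implicit Arguments.
Unset Strict Implicit.
Unset Printing Implicit Defensive.

Import Order.TTheory GRing.Theory Num.Theory numFieldNormedType.Exports.
Local Open Scope classical_set_scope.
Local Open Scope ring_scope.
Local Open Scope complex_scope.

Definition homeomorphism (S T : topologicalType) (f : S -> T) : Prop :=
  continuous f /\
  exists g : T -> S, [/\ cancel f g, cancel g f & continuous g].

(* [h : V -> U] is the (co)restriction of [p]; subsets coerce to subtypes with
   the subspace topology. *)
Definition evenly_covered (X Y : topologicalType) (p : X -> Y) (U : set Y) :
    Prop :=
  exists F : set (set X),
    [/\ forall V, F V -> open V,
        trivIset F id,
        p @^-1` U = \bigcup_(V in F) V &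
        forall V, F V -> exists h : V -> U,
          (forall x : V, \val (h x) = p (\val x)) /\ homeomorphism h].

Definition covering_map (X Y : topologicalType) (p : X -> Y) : Prop :=
  continuous p /\
  forall y : Y, exists U : set Y, [/\ open U, U y & evenly_covered p U].

Definition fold_covering (r : nat) (X Y : topologicalType) (p : X -> Y) :
    Prop :=
  covering_map p /\ forall y : Y, (p @^-1` [set y] #= `I_r)%card.

(* [R[i]^o] is [R[i]], seen as a normed space over itself; this is the copy on
   which the library puts the norm topology. *)
Definition circle (R : realType) : set R[i]^o := [set z | `|z| = 1].

Arguments circle : clear implicits.

Lemma circle_expr (R : realType) (n : nat) (x : circle R) :
  (\val x ^+ n : R[i]^o) \in circle R.
Proof.
by apply/mem_set; rewrite /circle/= normrX (set_mem (valP x)) expr1n.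
Qed.

Definition circle_pow (R : realType) (n : nat) (x : circle R) : circle R :=
  SigSub (circle_expr n x).

(* The bonding map from coordinate [n] to coordinate [n - 1] is [w n], for
   [n >= 1]; the value [w 0] is not used. *)
Definition solenoid (R : realType) (w : nat -> nat) :
    set (prod_topology (fun _ : nat => circle R)) :=
  [set x | forall n, (1 <= n)%N -> x n.-1 = circle_pow (w n) (x n)].

Arguments solenoid : clear implicits.

(* Main.v *)
(* Write cis t = exp(2 i pi t). The line t |-> (cis (t / (w 1 ... w n)))_n is
   dense in the solenoid Theta, so Theta is connected; it is also compact, and
   the sets of points whose n-th coordinate lies in a short arc (n large) form
   a neighbourhood basis.

   If r is coprime to w n for n > N, then x |-> x^r is an r-fold covering of
   Theta by itself: by Bezout, an r-th root of the coordinate n >= N of a point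
   extends uniquely to an r-th root of that point.

   Conversely, by compactness an r-fold covering X -> Theta admits, over every
   short arc of the n-th coordinate, a numbering of its sheets by 'I_r, and two
   neighbouring numberings differ by a constant permutation. Following them
   around the circle gives a monodromy permutation tau. One turn of the
   coordinate m >= n makes w (n+1) ... w m turns of the coordinate n, so a set
   of labels invariant under tau ^ (w (n+1) ... w m) gives a clopen subset of X.
   If X is connected, this power of tau is therefore transitive on 'I_r, which
   forces w (n+1) ... w m to be coprime to r. *)
Require Import Defs.
From mathcomp Require Import all_boot all_order all_algebra.
From mathcomp Require Import fingroup perm.
From mathcomp Require Import complex.
From mathcomp Require Import all_classical all_reals topology normedtype.
From mathcomp Require Import trigo.
From mathcomp Require Import ring lra.
Import Order.TTheory GRing.Theory Num.Theory numFieldNormedType.Exports.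
Local Open Scope classical_set_scope.

Set Implicit Arguments.
Unset Strict Implicit.
Unset Printing Implicit Defensive.
Local Open Scope ring_scope.
Local Open Scope complex_scope.

(** * The circle *)

Section Cis.
Variable R : realType.
Implicit Types (s t : R) (z : R[i]).

Definition cis t : R[i] := cos (2 * pi * t) +i* sin (2 * pi * t).

Lemma cisD s t : cis (s + t) = cis s * cis t.
Proof.
by rewrite /cis mulrDr cosD sinD; simpc; congr (_ +i* _); rewrite addrC mulrC.
Qed.

Lemma cis0 : cis 0 = 1.
Proof. by rewrite /cis mulr0 cos0 sin0. Qed.

Lemma normr_cis t : `|cis t| = 1.
Proof. by rewrite normc_def /= cos2Dsin2 sqrtr1. Qed.

Lemma cis_neq0 t : cis t != 0.
Proof. by rewrite -normr_eq0 normr_cis oner_eq0. Qed.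

Lemma cisN t : cis (- t) = (cis t)^-1.
Proof.
by apply: (mulIf (cis_neq0 t)); rewrite -cisD addNr cis0 mulVf // cis_neq0.
Qed.

Lemma cisX t n : cis (n%:R * t) = cis t ^+ n.
Proof.
elim: n => [|n IHn]; first by rewrite mul0r cis0.
by rewrite exprS -IHn -cisD mulrS mulrDl mul1r.
Qed.

Lemma cis1 : cis 1 = 1.
Proof. by rewrite /cis mulr1 mulr_natl cos2pi sin2pi. Qed.

Lemma cis_nat n : cis n%:R = 1.
Proof. by rewrite -[n%:R]mulr1 cisX cis1 expr1n. Qed.

Lemma cis_int (k : int) : cis k%:~R = 1.
Proof. by case: k => k; rewrite ?NegzE ?mulrNz ?cisN cis_nat ?invr1. Qed.

(** The arccosine of the real part gives the size of the angle, and the sign of the imaginary part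
    gives its sign. The bound on [t] and the cosine formula let [nbhs_circle] recover that size from
    the real part alone. *)
Lemma circle_cis z : `|z| = 1 ->
  exists2 t, z = cis t & `|t| <= 2^-1 /\ cos (2 * pi * `|t|) = complex.Re z.
Proof.
case: z => a b; rewrite normc_def /= => /(congr1 (@complex.Re R))/= h.
have ab1 : a ^+ 2 + b ^+ 2 = 1.
  by apply/eqP; rewrite -(eqr_sqrt _ ler01) ?addr_ge0 ?sqr_ge0 // h sqrtr1.
have a1 : -1 <= a <= 1 by have := sqr_ge0 b; nra.
have ppos := pi_gt0 R.
have [acos_ge acos_le acos_cos] : [/\ 0 <= acos a, acos a <= pi & cos (acos a) = a].
  by rewrite acos_ge0 // acos_lepi // acosK // in_itv.
have sinb : sin (acos a) = `|b|.
  by rewrite sin_acos // -sqrtr_sqr (_ : 1 - a ^+ 2 = b ^+ 2) // -ab1 addrC addKr.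
have mulpK c : 2 * pi * (c / (2 * pi)) = c :> R.
  by rewrite mulrC divfK // gt_eqF // mulr_gt0.
have tb : `|acos a / (2 * pi)| <= 2^-1.
  rewrite ger0_norm; last by rewrite divr_ge0 // mulr_ge0 // ltW.
  rewrite ler_pdivrMr; last by rewrite mulr_gt0.
  by rewrite mulKf // pnatr_eq0.
case: (lerP 0 b) => b0.
  exists (acos a / (2 * pi)).
    by rewrite /cis mulpK acos_cos sinb ger0_norm.
  split=> //=; rewrite ger0_norm ?mulpK //.
  by rewrite divr_ge0 // mulr_ge0 // ltW.
exists (- (acos a / (2 * pi))).
  by rewrite /cis mulrN mulpK cosN sinN acos_cos sinb ltr0_norm ?opprK.
rewrite normrN; split=> //=; rewrite ger0_norm ?mulpK //.
by rewrite divr_ge0 // mulr_ge0 // ltW.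
Qed.

(** By the double angle formula [sin (pi * |t|)] vanishes, whereas the sine is positive strictly
    between 0 and [pi]. *)
Lemma cis_eq1_small t : `|t| < 1 -> cis t = 1 -> t = 0.
Proof.
have ppos := pi_gt0 R => t1 /(congr1 (@complex.Re R))/=.
have -> : cos (2 * pi * t) = cos (2 * (pi * `|t|)).
  by rewrite -cos_norm !normrM normr_nat (gtr0_norm ppos) mulrA.
rewrite mulr_natl cos_mulr2n => h.
have : cos (pi * `|t|) ^+ 2 = 1 by move: h; rewrite mulr2n; lra.
move=> /eqP; rewrite cos2sin2 subr_eq addrC -subr_eq subrr eq_sym sqrf_eq0 => /eqP s0.
apply/eqP; rewrite -normr_eq0; apply/eqP/le_anti; rewrite normr_ge0 andbT leNgt.
apply/negP => t0; suff : 0 < sin (pi * `|t|) by rewrite s0 ltxx.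
by rewrite sin_gt0_pi // mulr_gt0 // gtr_pMr.
Qed.

Lemma cis_eq s t : cis s = cis t -> exists k : int, s = t + k%:~R.
Proof.
move=> st; exists (Num.floor (s - t)).
have /andP[f1 f2] := floor_itv (s - t).
have : s - t - (Num.floor (s - t))%:~R = 0; last first.
  by move=> /eqP; rewrite subr_eq0 => /eqP <-; rewrite addrC subrK.
apply: cis_eq1_small.
  by rewrite ger0_norm ?subr_ge0 // ltrBlDl -intrD1.
by rewrite !cisD !cisN cis_int st divff ?cis_neq0 // invr1 mulr1.
Qed.

End Cis.

(** * Subspaces, and arcs as neighbourhoods on the circle *)

Lemma nbhs_subtype (T : topologicalType) (A : set T) (x : A) (U : set A) :
  nbhs x U <-> exists2 V, nbhs (\val x) V & (\val : A -> T) @^-1` V `<=` U.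
Proof.
split=> [[B [[C oC <-] Cx] CU]|[V Vx VU]].
  by exists C => //; exact: open_nbhs_nbhs.
by apply: filterS VU _; apply: initial_continuous Vx.
Qed.

Lemma compact_subtype (T : topologicalType) (A : set T) :
  compact A -> compact [set: A].
Proof.
move=> cA F PF _; have GA : ((\val : A -> T) @ F) A.
  by rewrite /= nbhs_filterE; apply: (@filterE _ F) => a; apply: set_valP.
have [x [Ax clx]] := cA _ _ GA.
exists (SigSub (mem_set Ax)); split=> // B C FB /nbhs_subtype[V Vx VC].
have [|y [[b Bb <-] Vy]] := clx (\val @` B) V _ Vx.
  by rewrite /= nbhs_filterE; apply: filterS FB => b Bb; exists b.
by exists b; split=> //; apply: VC.
Qed.

Section CircleTopology.
Variable R : realType.
Implicit Types (z u : circle R) (A : set (circle R)).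

(* Closeness in angle: unlike the complex distance it is real-valued, and it
   scales by n under z |-> z ^+ n. *)
Definition cnear (e : R) (z u : R[i]) := exists2 s, `|s| < e & u = z * cis s.

Lemma normr_circle z : `|\val z : R[i]| = 1.
Proof. exact: (set_mem (valP z)). Qed.

Lemma circle_neq0 z : \val z != 0 :> R[i].
Proof. by rewrite -normr_eq0 normr_circle oner_eq0. Qed.

Lemma cis_near1 (e : R) : 0 < e -> \forall s \near (0 : R), `|cis s - 1| < e%:C.
Proof.
move=> e0.
have : cos (2 * pi * s) @[s --> (0:R)] --> (1 : R).
  rewrite -[X in _ --> X](@cos0 R) -[X in cos X](mulr0 (2 * pi)).
  apply: continuous_comp; last exact: continuous_cos.
  by apply: cvgM; [exact: cvg_cst|exact: cvg_id].
(* The threshold comes from the squared distance between [cis s] and 1, which is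
   [2 * (1 - cos (2 * pi * s))]. *)
move=> /cvgrPdist_lt/(_ (e ^+ 2 / 2)) h.
have {h} := h (divr_gt0 (exprn_gt0 _ e0) (ltr0n _ 2)).
apply: filterS => s hs.
rewrite normc_def ltcR -[ltRHS](gtr0_norm e0) -sqrtr_sqr /= ltr_sqrt ?exprn_gt0 //.
have := cos2Dsin2 (2 * pi * s); rewrite subr0 => cs.
move: hs; rewrite ltr_norml => /andP[_ hs].
suff -> : (cos (2 * pi * s) - 1) ^+ 2 + sin (2 * pi * s) ^+ 2 =
    2 * (1 - cos (2 * pi * s)) by lra.
have -> : sin (2 * pi * s) ^+ 2 = 1 - cos (2 * pi * s) ^+ 2 by lra.
by ring.
Qed.

Lemma nbhs_circle z A :
  nbhs z A <-> exists2 e : R, 0 < e & forall u, cnear e (\val z) (\val u) -> A u.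
Proof.
split.
  move=> /nbhs_subtype[V /nbhs_ballP[d /= d0 dV] VA].
  have dr : d = (complex.Re d)%:C.
    by case: d d0 {dV} => a b; rewrite ltcE /= => /andP[/eqP -> _].
  have [|e /= e0 he] := (nbhs_ballP _ _).1 (@cis_near1 (complex.Re d) _).
    by rewrite -ltcR -dr.
  exists e => // u [s se us]; apply/VA/dV; rewrite /ball /= us.
  rewrite -[X in X - _]mulr1 -mulrBr normrM normr_circle mul1r distrC dr.
  by apply: he; rewrite /ball /= sub0r normrN.
(* Up to half a turn the cosine decreases, so a unit ratio with real part above [cos (2 * pi * e')]
   has angle below [e']. A ball of radius [1 - cos (2 * pi * e')] ensures this. *)
move=> [e e0 eA]; pose e' := Num.min e 2^-1.
have e'0 : 0 < e' by rewrite lt_min e0 invr_gt0 ltr0n.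
have e'2 : e' <= 2^-1 by rewrite ge_min lexx orbT.
have ppos := pi_gt0 R.
have half (a : R) : a <= 2^-1 -> 2 * pi * a <= pi.
  by move=> a2; have := ler_wpM2l (ltW ppos) a2; lra.
have c1 : cos (2 * pi * e') < 1.
  have pe : 0 < 2 * pi * e' by rewrite !mulr_gt0.
  by rewrite -[ltRHS]cos0 ltr_cos // in_itv /= ?lexx ?(ltW pe) ?half ?(ltW ppos).
apply/nbhs_subtype; exists (ball (\val z) (1 - cos (2 * pi * e'))%:C).
  by apply: nbhsx_ballx; rewrite ltcR subr_gt0.
move=> u; rewrite /preimage /= /ball /= => zu.
have uz : `|\val u / \val z : R[i]| = 1 by rewrite normf_div !normr_circle divr1.
have [t ut [t2 ct]] := circle_cis uz.
apply: eA; exists t; last by rewrite -ut mulrC divfK // circle_neq0.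
suff : `|t| < e' by move=> /lt_le_trans; apply; rewrite ge_min lexx.
have : `|1 - \val u / \val z : R[i]| < (1 - cos (2 * pi * e'))%:C.
  by rewrite -[X in `|X - _|](divff (circle_neq0 z)) -mulrBl normf_div normr_circle divr1.
move=> /(le_lt_trans (normc_ge_Re _)); rewrite ltcR => /(le_lt_trans (ler_norm _)).
rewrite raddfB /= -ct ltrD2l ltrN2 ltr_cos; last 2 first.
- by rewrite in_itv /= half // !mulr_ge0 // ltW.
- by rewrite in_itv /= half // !mulr_ge0 // ltW.
by rewrite ltr_pM2l // mulr_gt0.
Qed.

End CircleTopology.

Section CNear.
Variable R : realType.
Implicit Types (d e s t : R) (z u v : R[i]).

Lemma cnear_refl e z : 0 < e -> cnear e z z.
Proof. by move=> e0; exists 0; rewrite ?normr0 ?cis0 ?mulr1. Qed.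

Lemma cnear_sym e z u : cnear e z u -> cnear e u z.
Proof.
move=> [s se ->]; exists (- s); first by rewrite normrN.
by rewrite cisN mulfK // cis_neq0.
Qed.

Lemma cnear_trans d e z u v : cnear d z u -> cnear e u v -> cnear (d + e) z v.
Proof.
move=> [s sd ->] [t te ->]; exists (s + t); last by rewrite cisD mulrA.
by rewrite (le_lt_trans (ler_normD _ _)) // ltrD.
Qed.

Lemma cnear_le d e z u : d <= e -> cnear d z u -> cnear e z u.
Proof. by move=> de [s sd ->]; exists s => //; apply: lt_le_trans de. Qed.

Lemma cnear_exp k e z u : (0 < k)%N ->
  cnear e z u -> cnear (k%:R * e) (z ^+ k) (u ^+ k).
Proof.
move=> k0 [s se ->]; exists (k%:R * s); last by rewrite exprMn cisX.
by rewrite normrM normr_nat ltr_pM2l // ltr0n.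
Qed.

Lemma cnear_cisD s e t : `|s| < e -> cnear e (cis t) (cis (t + s)).
Proof. by move=> se; exists s; rewrite ?cisD. Qed.

(** If [u] were [z] turned by a nonzero angle [s] below 1/2, it would also be [z] turned by some [t]
    smaller than [s] in size. Then [s - t] is a whole number of turns of size below 1, so [s = t], a
    contradiction. *)
Lemma cnear_eq z u : z != 0 -> (forall e, 0 < e -> cnear e z u) -> z = u.
Proof.
move=> z0 zu; have [|s s2 us] := zu 2^-1; first by rewrite invr_gt0 ltr0n.
have [s0|s0] := eqVneq s 0; first by rewrite us s0 cis0 mulr1.
have [|t ts ut] := zu `|s|; first by rewrite normr_gt0.
have : s - t = 0.
  apply: cis_eq1_small.
    rewrite (le_lt_trans (ler_normB _ _)) // (lt_le_trans (ltrD s2 (lt_trans ts s2))) //.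
    by lra.
  rewrite cisD cisN; move: us; rewrite ut => /(mulfI z0) ->.
  by rewrite divff // cis_neq0.
by move=> /eqP; rewrite subr_eq0 => /eqP st; rewrite st ltxx in ts.
Qed.

Definition cis_circle t : circle R := SigSub (mem_set (normr_cis t) : cis t \in circle R).

Lemma continuous_cis_circle : continuous cis_circle.
Proof.
move=> t A /nbhs_circle[e e0 eA]; rewrite nbhs_filterE /=.
apply/nbhs_ballP; exists e => //= s; rewrite /ball /= distrC => st; apply: eA.
by have := cnear_cisD t st; rewrite addrC subrK.
Qed.

Lemma compact_circle : compact [set: circle R].
Proof.
have -> : [set: circle R] = cis_circle @` `[- 2^-1, 2^-1]%classic.
  apply/seteqP; split=> // z _; have [t zt [t2 _]] := circle_cis (normr_circle z).
  exists t; last by apply: val_inj; rewrite /= zt.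
  by rewrite /= in_itv /= -ler_norml.
apply: continuous_compact; last exact: segment_compact.
exact/continuous_subspaceT/continuous_cis_circle.
Qed.

End CNear.

(** * The solenoid *)

Section Solenoid.
Variables (R : realType) (w : nat -> nat).
Hypothesis hw : forall n, (1 <= n)%N -> (1 < w n)%N.
Local Notation Theta := (solenoid R w).
Implicit Types (x y : Theta) (k m n : nat).

Definition pr n x : R[i] := \val ((\val x : nat -> circle R) n).

(** For [k <= n], the degree of the composite bonding map from coordinate [n] to coordinate [k]. *)
Definition wprod k n := (\prod_(k.+1 <= i < n.+1) w i)%N.

Lemma wprod_gt0 k n : (0 < wprod k n)%N.
Proof.
rewrite /wprod big_seq; apply: prodn_cond_gt0 => i.
by rewrite mem_index_iota => /andP[i0 _]; apply/ltnW/hw/(leq_trans _ i0).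
Qed.

Lemma wprod_cat k m n : (k <= m <= n)%N -> wprod k n = (wprod k m * wprod m n)%N.
Proof. by move=> /andP[km mn]; rewrite /wprod -big_cat_nat. Qed.

Lemma wprodS n : wprod 0 n.+1 = (wprod 0 n * w n.+1)%N.
Proof. by rewrite /wprod big_nat_recr. Qed.

Lemma pr_norm n x : `|pr n x| = 1.
Proof. exact: normr_circle. Qed.

Lemma pr_neq0 n x : pr n x != 0.
Proof. exact: circle_neq0. Qed.

Lemma pr_succ n x : pr n x = pr n.+1 x ^+ w n.+1.
Proof. by rewrite /pr (set_valP x n.+1 (ltn0Sn n)). Qed.

Lemma pr_exp k n x : (k <= n)%N -> pr k x = pr n x ^+ wprod k n.
Proof.
elim: n => [|n IHn]; first by rewrite leqn0 => /eqP ->; rewrite /wprod big_geq.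
rewrite leq_eqVlt => /predU1P[->|]; first by rewrite /wprod big_geq.
rewrite ltnS => kn; rewrite (IHn kn) (pr_succ n) -exprM.
by rewrite /wprod (big_nat_recr n.+1) 1?mulnC.
Qed.

Lemma pr_inj x y : (forall n, pr n x = pr n y) -> x = y.
Proof.
move=> xy; apply: val_inj; apply: functional_extensionality_dep => n.
exact: val_inj (xy n).
Qed.

Lemma solenoid_mk (f : nat -> R[i]) : (forall n, `|f n| = 1) ->
  (forall n, f n = f n.+1 ^+ w n.+1) -> exists x, forall n, pr n x = f n.
Proof.
move=> f1 fS; pose g n : circle R := SigSub (mem_set (f1 n) : f n \in circle R).
have gP : solenoid R w g.
  by move=> [//|n] _; apply: val_inj => /=; rewrite fS.
by exists (SigSub (mem_set gP)).
Qed.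

(* With this radius, being close at the coordinate n implies being within
   1/(n+1) at all previous coordinates: these arcs form a basis. *)
Definition radius n : R := (n.+1%:R * (wprod 0 n)%:R)^-1.

Lemma radius_gt0 n : 0 < radius n.
Proof. by rewrite invr_gt0 mulr_gt0 // ltr0n // wprod_gt0. Qed.

Lemma cnear_pr m n e x y : (m <= n)%N ->
  cnear e (pr n x) (pr n y) -> cnear ((wprod m n)%:R * e) (pr m x) (pr m y).
Proof. by move=> mn xy; rewrite !(pr_exp _ mn); apply: cnear_exp; rewrite ?wprod_gt0. Qed.

Lemma wprod_radiusE m n : (m <= n)%N ->
  (wprod m n)%:R * radius n = (n.+1%:R * (wprod 0 m)%:R)^-1.
Proof.
move=> mn; rewrite /radius (@wprod_cat 0 m n) ?mn // natrM.
rewrite !invfM mulrCA [X in _ * X]mulrCA divff ?mulr1 //.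
by rewrite pnatr_eq0 -lt0n wprod_gt0.
Qed.

Lemma wprod_radius m n : (m <= n)%N -> (wprod m n)%:R * radius n <= radius m.
Proof.
move=> mn; rewrite wprod_radiusE // /radius lef_pV2 ?posrE ?mulr_gt0 ?ltr0n ?wprod_gt0 //.
by rewrite ler_pM2r ?ler_nat // ltr0n wprod_gt0.
Qed.

Lemma cnear_radius m n x y : (m <= n)%N ->
  cnear (radius n) (pr n x) (pr n y) -> cnear (radius m) (pr m x) (pr m y).
Proof. by move=> mn /(cnear_pr mn); apply: cnear_le; apply: wprod_radius. Qed.

Lemma continuous_pr n : continuous (fun x : Theta => (\val x : nat -> circle R) n).
Proof.
pose P := prod_topology (fun _ : nat => circle R).
move=> x; apply: (@continuous_comp _ _ _ (\val : Theta -> P)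
  (@proj nat (fun=> circle R) n)).
  exact: initial_continuous.
exact: proj_continuous.
Qed.

Lemma nbhs_cnear n e x : 0 < e -> \forall y \near x, cnear e (pr n x) (pr n y).
Proof.
move=> e0; have : nbhs ((\val x : nat -> circle R) n) [set u | cnear e (pr n x) (\val u)].
  by apply/nbhs_circle; exists e.
by move=> /continuous_pr; rewrite nbhs_filterE.
Qed.

Lemma nbhs_solenoid x (A : set Theta) :
  nbhs x A <-> exists n, forall y, cnear (radius n) (pr n x) (pr n y) -> A y.
Proof.
split=> [/nbhs_subtype[V xV VA]|[n nA]]; last first.
  by apply: filterS nA _; exact: nbhs_cnear (radius_gt0 n).
(* The images of the arcs about [x] generate a filter on the product. It converges to [x] because
   every coordinate does, and convergence puts one of the arcs inside [V]. *)
pose F : set_system (prod_topology (fun _ : nat => circle R)) := filter_from setT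
  (fun n => [set \val y | y in [set y | cnear (radius n) (pr n x) (pr n y)]]).
have FF : Filter F.
  apply: filter_from_filter; first by exists 0%N.
  move=> m n _ _; exists (maxn m n) => // _ [y xy <-].
  by split; exists y => //; apply: cnear_radius xy; rewrite ?leq_maxl ?leq_maxr.
have : F --> (\val x : prod_topology (fun _ : nat => circle R)).
  apply/cvg_sup => k U [_ [[C oC <-] /= Ck CU]].
  have /nbhs_circle[e e0 eC] : nbhs ((\val x : nat -> circle R) k) C.
    exact: open_nbhs_nbhs.
  have [n kn ne] : exists2 n, (k <= n)%N & n.+1%:R^-1 < e.
    exists (maxn k (Num.truncn e^-1)); first exact: leq_maxl.
    rewrite invf_plt ?posrE ?ltr0n //.
    apply: lt_le_trans (truncnS_gt _) _.
    by rewrite ler_nat ltnS leq_maxr.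
  exists n => // _ [y xy <-]; apply/CU/eC.
  apply: cnear_le (cnear_pr kn xy); apply: le_trans (ltW ne).
  rewrite wprod_radiusE // lef_pV2 ?posrE ?mulr_gt0 ?ltr0n ?wprod_gt0 //.
  by rewrite ler_peMr ?ler0n // ler1n wprod_gt0.
move=> /(_ _ xV)[n _ nV]; exists n => y xy; apply: VA; apply: nV; by exists y.
Qed.

Lemma cis_line t : exists x, forall n, pr n x = cis (t / (wprod 0 n)%:R).
Proof.
apply: (@solenoid_mk (fun n => cis (t / (wprod 0 n)%:R))) => n; first exact: normr_cis.
rewrite -cisX wprodS natrM invfM mulrCA [(w n.+1)%:R * (_ * _)]mulrCA divff ?mulr1 //.
by rewrite pnatr_eq0 -lt0n; apply/ltnW/hw.
Qed.

Definition line t : Theta := projT1 (cid (cis_line t)).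

Lemma pr_line n t : pr n (line t) = cis (t / (wprod 0 n)%:R).
Proof. by rewrite /line; case: cid. Qed.

Lemma pr_line_surj n z : `|z| = 1 -> exists t, pr n (line t) = z.
Proof.
move=> /circle_cis[t -> _]; exists (t * (wprod 0 n)%:R).
by rewrite pr_line mulfK // pnatr_eq0 -lt0n wprod_gt0.
Qed.

Lemma continuous_line : continuous line.
Proof.
move=> t A /nbhs_solenoid[n nA]; rewrite nbhs_filterE /=.
have Q0 : 0 < (wprod 0 n)%:R :> R by rewrite ltr0n wprod_gt0.
apply/nbhs_ballP; exists (radius n * (wprod 0 n)%:R).
  by rewrite /= mulr_gt0 // radius_gt0.
move=> s; rewrite /ball /= distrC => st; apply: nA.
rewrite !pr_line.
have -> : s / (wprod 0 n)%:R = t / (wprod 0 n)%:R + (s - t) / (wprod 0 n)%:R.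
  by rewrite -mulrDl addrC subrK.
by apply: cnear_cisD; rewrite normrM normfV (gtr0_norm Q0) ltr_pdivrMr.
Qed.

Lemma connected_solenoid : connected [set: Theta].
Proof.
have <- : closure (range line) = [set: Theta].
  apply/seteqP; split=> // x _ A /nbhs_solenoid[n nA].
  have [t tx] := pr_line_surj n (pr_norm n x).
  by exists (line t); split=> //; apply: nA; rewrite tx; apply: cnear_refl (radius_gt0 n).
apply/connected_closure/connected_continuous_connected.
  by apply/connected_intervalP => a b _ _ c _.
exact/continuous_subspaceT/continuous_line.
Qed.

Lemma compact_solenoid : compact [set: Theta].
Proof.
apply: compact_subtype; pose P := prod_topology (fun _ : nat => circle R).
have cP : compact [set: P].
  have -> : [set: P] = [set f : forall n : nat, circle R | forall n, [set: circle R] (f n)].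
    by apply/seteqP; split.
  exact: (@tychonoff nat (fun=> circle R) (fun=> setT) (fun=> @compact_circle R)).
apply: (subclosed_compact _ cP) => //.
move=> x clx [//|n] _ /=; apply: val_inj => /=.
pose f (y : P) (k : nat) : R[i] := \val (y k).
have near_f k e : 0 < e -> \forall y \near (x : P), cnear e (f x k) (f y k).
  move=> e0; have : nbhs (x k) [set u | cnear e (f x k) (\val u)].
    by apply/nbhs_circle; exists e.
  by move=> /(@proj_continuous nat (fun=> circle R) k x); rewrite nbhs_filterE.
apply: (@cnear_eq R); first exact: circle_neq0.
move=> e e0; have w0 : (0 < w n.+1)%N by apply/ltnW/hw.
have w0r : 0 < (w n.+1)%:R :> R by rewrite ltr0n.
(* Raising to the power [w n.+1] multiplies angles by [w n.+1], so this tolerance at coordinate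
   [n.+1] becomes [e / 2] at coordinate [n]. *)
have e1 : 0 < e / 2 / (w n.+1)%:R by rewrite !divr_gt0.
have [y [yT]] := clx _ (filterI (near_f n _ (divr_gt0 e0 (ltr0n R 2))) (near_f n.+1 _ e1)).
move=> [xyn /(cnear_exp w0)]; rewrite mulrCA divff ?gt_eqF // mulr1 => /cnear_sym.
have <- : f y n = f y n.+1 ^+ w n.+1 by rewrite /f (yT n.+1).
by move=> /(cnear_trans xyn); rewrite -splitr.
Qed.

End Solenoid.

(** * Open maps with finite fibers *)

Lemma fiber_enum (r : nat) (X Y : Type) (p : X -> Y) (y : Y) :
  (p @^-1` [set y] #= `I_r)%card ->
  exists2 g : 'I_r -> X, injective g & forall a, p a = y <-> exists i, g i = a.
Proof.
move=> /card_set_bijP[f [/= fI finj fsurj]].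
have fi (i : 'I_r) : exists a, p a = y /\ f a = i.
  by have [a pa fa] := fsurj i (ltn_ord i); exists a.
have [g gP] := choice fi.
exists g => [i j gij|a].
  by apply: val_inj; have [_ /= <-] := gP i; have [_ /= <-] := gP j; rewrite gij.
split=> [pa|[i <-]]; last by have [] := gP i.
exists (Ordinal (fI a pa)); have [pg fg] := gP (Ordinal (fI a pa)).
by apply: finj; rewrite ?inE.
Qed.

Section OpenCovering.
Variables (r : nat) (X Y : topologicalType) (p : X -> Y).

Lemma hausdorff_fin_separate (g : 'I_r -> X) : hausdorff_space X -> injective g ->
  exists D : 'I_r -> set X, [/\ forall i, open (D i), forall i, D i (g i) &
    forall i j a, D i a -> D j a -> i = j].
Proof.
move=> hX ginj.
have sepP (ij : 'I_r * 'I_r) : exists AB : set X * set X, ij.1 != ij.2 ->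
    [/\ nbhs (g ij.1) AB.1, nbhs (g ij.2) AB.2 & AB.1 `&` AB.2 = set0].
  have [ij0|ij0] := eqVneq ij.1 ij.2; first by exists (setT, setT).
  have gij : g ij.1 != g ij.2 by apply: contra_neq ij0; exact: ginj.
  move: hX; rewrite open_hausdorff => /(_ (g ij.1) (g ij.2) gij).
  move=> [[A B] /= [/set_mem gA /set_mem gB] [oA oB /eqP AB]].
  by exists (A, B) => _; split=> //; exact: open_nbhs_nbhs.
have [AB ABP] := choice sepP.
(* Both orders of each pair are used: [D i] lies in the first half of the pair [(i, j)] and [D j] in
   its second half, and these are disjoint. *)
exists (fun i => [set a | forall j, i != j ->
  (AB (i, j)).1 a /\ (AB (j, i)).2 a]^°); split=> [i|i|i j a].
- exact: open_interior.
- apply: filter_forall => j; have [->|ij] := eqVneq i j; first exact: filterE.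
  have [hi _ _] := ABP (i, j) ij; rewrite eq_sym in ij.
  by have [_ hi' _] := ABP (j, i) ij; apply: filterS2 hi hi'.
- move=> /interior_subset Di /interior_subset Dj; apply/eqP/negPn/negP => ij.
  have [Di1 _] := Di j ij; have [_ Dj2] := Dj i (introN eqP (nesym (elimN eqP ij))).
  by have [_ _ AB0] := ABP (i, j) ij; have : set0 a by rewrite -AB0.
Qed.

(** Disjoint open sets around the points of one fiber have images that are neighbourhoods of its
    base point. Over the interior of the intersection of these images each open set contains a point
    of every fiber, hence exactly one, as fibers have [r] points. Openness of [p] makes the
    resulting sections continuous. *)
Lemma open_fold_covering : hausdorff_space X -> continuous p ->
  (forall a A, nbhs a A -> nbhs (p a) (p @` A)) ->
  (forall y, (p @^-1` [set y] #= `I_r)%card) -> fold_covering r p.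
Proof.
move=> hX pc po pr; split=> //; split=> // y.
have [g ginj gy] := fiber_enum (pr y).
have [D [oD Dg Ddisj]] := hausdorff_fin_separate hX ginj.
pose U : set Y := [set u | forall i, (p @` D i) u]^°.
have Uy : U y.
  apply: filter_forall => i; have pgi : p (g i) = y by apply/gy; exists i.
  by rewrite -pgi; apply: po; apply: open_nbhs_nbhs.
(* Points chosen in the [r] disjoint sets are distinct, so they exhaust the fiber: an injection of
   ['I_r] into itself is onto. *)
have fibU u b a : (forall i, D i (b i) /\ p (b i) = u) -> p a = u ->
    exists i, b i = a.
  move=> bP pa; have [c cinj cu] := fiber_enum (pr u).
  have bc i : exists j, c j = b i by apply/cu; case: (bP i).
  have [s sP] := choice bc.
  have sinj : injective s.
    move=> i j sij; have [Dbi _] := bP i; have [Dbj _] := bP j.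
    by apply: Ddisj Dbi _; rewrite -sP sij sP.
  have /cu[k <-] := pa; have [s' s'K sK'] := injF_bij sinj.
  by exists (s' k); rewrite -sP sK'.
have selU u : U u -> exists b : 'I_r -> X, forall i, D i (b i) /\ p (b i) = u.
  move=> /interior_subset uU.
  have h i : exists a, D i a /\ p a = u by have [a] := uU i; exists a.
  by have [b bP] := choice h; exists b.
have DU a : U (p a) -> exists i, D i a.
  by move=> /selU[b bP]; have [i <-] := fibU _ _ a bP erefl; exists i; case: (bP i).
have Uinj i a b : U (p a) -> p b = p a -> D i a -> D i b -> a = b.
  move=> /selU[c cP] pb Da Db.
  (* Putting [a] in slot [i] of a selection gives another selection, which must contain [b];
     disjointness then places [b] in slot [i]. *)
  have c'P j : D j (if j == i then a else c j) /\ p (if j == i then a else c j) = p a.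
    by case: eqP => [->|].
  have [j jb] := fibU _ _ b c'P pb; have [Dj _] := c'P j.
  by rewrite -jb (_ : j = i) ?eqxx //; rewrite jb in Dj; apply: Ddisj Dj Db.
exists U; split=> //; first exact: open_interior.
exists (range (fun i => D i `&` p @^-1` U)); split.
- move=> _ [i _ <-]; apply: openI => //.
  by apply: open_comp => [? _|]; [exact: pc|exact: open_interior].
- by move=> _ _ [i _ <-] [j _ <-] [a [[Di _] [Dj _]]]; rewrite (Ddisj _ _ _ Di Dj).
- apply/seteqP; split=> [a /= Ua|a [_ [i _ <-] []] //].
  by have [i Di] := DU a Ua; exists (D i `&` p @^-1` U) => //; exists i.
move=> _ [i _ <-]; set V := _ `&` _.
have hU (x : V) : p (\val x) \in U by apply/mem_set; have [] := set_valP x.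
exists (fun x => SigSub (hU x)); split=> //; split.
  move=> x A /nbhs_subtype[B xB BA]; rewrite nbhs_filterE /=.
  apply/nbhs_subtype; exists (p @^-1` B); first exact: pc.
  by move=> x' Bx'; apply: BA.
have kP (u : U) : exists x : V, p (\val x) = \val u.
  have [b bP] := selU _ (set_valP u); have [Db pb] := bP i.
  have Vb : V (b i) by split; rewrite //= pb; exact: set_valP.
  by exists (SigSub (mem_set Vb)).
have [k kK] := choice kP.
have VI (x x' : V) : p (\val x) = p (\val x') -> x = x'.
  have [Dx Ux] := set_valP x; have [Dx' _] := set_valP x'.
  by move=> pxx'; apply: val_inj; apply: (Uinj i).
exists k; split=> [x|u|u A /nbhs_subtype[B uB BA]].
- by apply: VI; rewrite kK.
- by apply: val_inj; rewrite /= kK.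
- rewrite nbhs_filterE /=; apply/nbhs_subtype.
  exists (p @` (V `&` B)).
    rewrite -(kK u); apply: po; apply: filterI => //.
    apply: open_nbhs_nbhs; split; last exact: set_valP.
    by apply: openI => //; apply: open_comp => [? _|]; [exact: pc|exact: open_interior].
  move=> u' [b [Vb Bb] pb]; apply: BA.
  by rewrite /preimage /= (_ : k u' = SigSub (mem_set Vb)) //; apply: VI; rewrite kK.
Qed.

End OpenCovering.

(** * The power covering *)

Section PowerCovering.
Variables (R : realType) (w : nat -> nat).
Hypothesis hw : forall n, (1 <= n)%N -> (1 < w n)%N.
Local Notation Theta := (solenoid R w).
Implicit Types (x y : Theta) (k m n : nat).

Lemma hausdorff_solenoid : hausdorff_space Theta.
Proof.
move=> x y xy; apply: pr_inj => n; apply: cnear_eq; first exact: pr_neq0.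
move=> e e0; have e2 : 0 < e / 2 by rewrite divr_gt0.
have [z [xz yz]] := xy _ _ (nbhs_cnear n x e2) (nbhs_cnear n y e2).
by rewrite [e]splitr; apply: cnear_trans xz (cnear_sym yz).
Qed.

Lemma solenoid_pow r : exists p : Theta -> Theta, forall x n, pr n (p x) = pr n x ^+ r.
Proof.
suff h x : exists y, forall n, pr n y = pr n x ^+ r.
  by have [p pP] := choice h; exists p.
apply: (solenoid_mk (f := fun n => pr n x ^+ r)) => n.
  by rewrite normrX pr_norm expr1n.
by rewrite pr_succ exprAC.
Qed.

Section Roots.
Variables (r N : nat).
Hypothesis hr : (1 <= r)%N.
Hypothesis hN : forall n, (N < n)%N -> coprime r (w n).

(** Bezout gives [a * w k.+1 = b * r + 1], and the root is [z ^+ a / pr k.+1 y ^+ b]. Both of its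
    required powers follow from [z ^+ r = pr k y] and this relation. *)
Lemma root_lift_step y k (z : R[i]) : (N <= k)%N -> `|z| = 1 -> z ^+ r = pr k y ->
  exists z' : R[i], [/\ `|z'| = 1, z' ^+ w k.+1 = z & z' ^+ r = pr k.+1 y].
Proof.
move=> Nk z1 zr; have wk : (0 < w k.+1)%N by apply/ltnW/hw.
have /(coprimeP _ wk)[[a b] /= ab] : coprime (w k.+1) r by rewrite coprime_sym hN.
have {}ab : (a * w k.+1 = b * r + 1)%N.
  by rewrite -ab addnC subnK // ltnW // -subn_gt0 ab.
exists (z ^+ a / pr k.+1 y ^+ b); split.
- by rewrite normf_div !normrX z1 pr_norm !expr1n divr1.
- rewrite expr_div_n -!exprM ab exprD expr1 (mulnC b r) (exprM z) zr pr_succ -exprM.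
  by rewrite (mulnC b) mulrC mulKf // expf_neq0 // pr_neq0.
- rewrite expr_div_n -!exprM (mulnC a) (exprM z) zr pr_succ -exprM (mulnC (w _)).
  by rewrite ab exprD expr1 mulrC mulKf // expf_neq0 // pr_neq0.
Qed.

Variable p : Theta -> Theta.
Hypothesis pE : forall x n, pr n (p x) = pr n x ^+ r.

Lemma root_lift y n (z : R[i]) : (N <= n)%N -> `|z| = 1 -> z ^+ r = pr n y ->
  exists2 x, pr n x = z & p x = y.
Proof.
move=> Nn z1 zr.
pose P k (u : R[i]) := `|u| = 1 /\ u ^+ r = pr (n + k) y.
have stepP (ku : nat * R[i]) : exists u', P ku.1 ku.2 ->
    P ku.1.+1 u' /\ u' ^+ w (n + ku.1).+1 = ku.2.
  have [[u1 ur]|nP] := pselect (P ku.1 ku.2); last by exists 0.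
  have [u' [u'1 u'w u'r]] := root_lift_step (leq_trans Nn (leq_addr ku.1 n)) u1 ur.
  by exists u' => _; rewrite /P addnS.
have [S SP] := choice stepP.
pose g := fix g k := if k is k'.+1 then S (k', g k') else z.
have gP k : P k (g k).
  by elim: k => [|k IHk]; [rewrite /P addn0|have [] := SP (k, g k) IHk].
have gS k : g k = g k.+1 ^+ w (n + k).+1 by have [_ ->] := SP (k, g k) (gP k).
have gcat i k : (i <= n + k)%N -> g k ^+ wprod w i (n + k) = g k.+1 ^+ wprod w i (n + k).+1.
  by move=> ik; rewrite gS -exprM /wprod [in RHS]big_nat_recr ?ltnS //= mulnC.
(* Since [g k] is meant as coordinate [n + k], coordinate [k] is its image under the bonding maps.
   This one formula also covers the coordinates below [n]. *)
have [x xP] : exists x, forall k, pr k x = g k ^+ wprod w k (n + k).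
  apply: (solenoid_mk (f := fun k => g k ^+ wprod w k (n + k))) => k.
    by rewrite normrX (gP k).1 expr1n.
  rewrite gcat ?leq_addl // -exprM addnS; congr (_ ^+ _).
  by rewrite /wprod [in LHS]big_ltn ?ltnS ?leq_addl // mulnC.
have gn i : g i ^+ wprod w n (n + i) = z.
  elim: i => [|i IHi]; first by rewrite addn0 /wprod big_geq.
  by rewrite addnS -gcat ?leq_addr.
exists x; first by rewrite xP.
apply: pr_inj => k; rewrite pE xP -exprM mulnC exprM (gP k).2.
by rewrite -pr_exp ?leq_addl.
Qed.

(** Going up one coordinate, with [a * w m.+1 = b * r + 1]: the powers [b * r + 1] agree because
    coordinate [m] does, the powers [b * r] agree because the images under [p] do, and the quotient
    is the coordinate itself. *)
Lemma root_inj n x x' : (N <= n)%N -> pr n x = pr n x' -> p x = p x' -> x = x'.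
Proof.
move=> Nn xx' pxx'.
suff h k : pr (n + k) x = pr (n + k) x'.
  by apply: pr_inj => k; rewrite !(@pr_exp _ _ k (n + k)) ?leq_addl // h.
elim: k => [|k IHk]; first by rewrite addn0.
rewrite addnS; set m := (n + k)%N in IHk *.
have wm : (0 < w m.+1)%N by apply/ltnW/hw.
have /(coprimeP _ wm)[[a b] /= ab] : coprime (w m.+1) r.
  by rewrite coprime_sym hN // ltnS (leq_trans Nn) // leq_addr.
have {}ab : (a * w m.+1 = b * r + 1)%N.
  by rewrite -ab addnC subnK // ltnW // -subn_gt0 ab.
have e1 : pr m.+1 x ^+ (b * r + 1) = pr m.+1 x' ^+ (b * r + 1).
  by rewrite -ab mulnC !exprM -!pr_succ IHk.
have e2 : pr m.+1 x ^+ (b * r) = pr m.+1 x' ^+ (b * r).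
  by rewrite mulnC !exprM -!pE pxx'.
move: e1; rewrite !exprD e2 !expr1; apply: mulfI.
by rewrite expf_neq0 // pr_neq0.
Qed.

(** A point near [p x] differs from it by a small angle [s] at a late coordinate; turning [x] by
    [s / r] there and lifting yields a preimage near [x]. *)
Lemma root_open x (A : set Theta) : nbhs x A -> nbhs (p x) (p @` A).
Proof.
move=> /nbhs_solenoid -/(_ hw)[m mA]; pose n := maxn m N.
have r0 : 0 < r%:R :> R by rewrite ltr0n.
have := @nbhs_cnear R w n (r%:R * radius R w n) (p x) (mulr_gt0 r0 (radius_gt0 _ hw _)).
apply: filterS => y [s sr ys].
have [||z zn pz] := @root_lift y n (pr n x * cis (s / r%:R)) (leq_maxr _ _).
- by rewrite normrM pr_norm normr_cis mulr1.
- by rewrite exprMn -cisX [r%:R * _]mulrC divfK ?gt_eqF // ys pE.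
exists z => //; apply: mA; apply: (cnear_radius hw (leq_maxl m N)).
exists (s / r%:R) => //.
by rewrite normrM normfV (gtr0_norm r0) ltr_pdivrMr // mulrC.
Qed.

(** If [pr N y = cis t], the possible coordinates [N] over [y] are the [r] numbers
    [cis ((t + k) / r)] with [k < r]. Each occurs by [root_lift], for a single point by
    [root_inj]. *)
Lemma root_fiber y : (p @^-1` [set y] #= `I_r)%card.
Proof.
have r0 : 0 < r%:R :> R by rewrite ltr0n.
have rn0 := lt0r_neq0 r0.
have [t yt _] := circle_cis (pr_norm N y).
have fP x : exists k, p x = y -> (k < r)%N /\ pr N x = cis ((t + k%:R) / r%:R).
  have [pxy|] := pselect (p x = y); last by exists 0%N.
  have [s xs _] := circle_cis (pr_norm N x).
  have : cis (r%:R * s) = cis t by rewrite cisX -xs -pE pxy.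
  move=> /cis_eq[j rs]; exists `|j %% r|%Z%N => _.
  have r0z : (r%:Z != 0)%R by rewrite -lt0n.
  have jr : (`|j %% r|%Z%N)%:Z = (j %% r)%Z by rewrite gez0_abs // modz_ge0.
  split; first by rewrite -ltz_nat jr ltz_pmod.
  rewrite xs -[s](mulKf rn0) rs {1}(divz_eq j r) -jr intrD intrM.
  rewrite [X in t + X]addrC addrA mulrDr mulrC [r%:R^-1 * _]mulrC.
  have -> : ((j %/ r)%Z)%:~R * (r%:Z)%:~R / r%:R = ((j %/ r)%Z)%:~R :> R.
    by rewrite mulfK // gt_eqF.
  by rewrite cisD cis_int mulr1.
have [f fE] := choice fP.
apply/card_set_bijP; exists f; split.
- by move=> x /fE[].
- move=> x x' /set_mem xy /set_mem x'y fxx'; apply: (@root_inj N) => //.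
    by have [_ ->] := fE x xy; have [_ ->] := fE x' x'y; rewrite fxx'.
  by rewrite [LHS]xy x'y.
move=> k /= kr.
have [||x xN pxy] := @root_lift y N (cis ((t + k%:R) / r%:R)) (leqnn _).
- exact: normr_cis.
- by rewrite -cisX mulrC divfK ?gt_eqF // cisD cis_nat mulr1 yt.
exists x => //; have [fr] := fE x pxy; rewrite xN => /cis_eq[j].
move=> /(congr1 ( *%R^~ r%:R)) /=; rewrite divfK // mulrDl divfK // -addrA => /addrI h.
have /(congr1 (modz^~ r)) : k%:Z = j * r + f x.
  by apply: (@intr_inj R); rewrite intrD intrM -!pmulrn h addrC.
by rewrite /= modzMDl !modz_nat !modn_small // => -[].
Qed.

End Roots.

Lemma solenoid_covering r N : (1 <= r)%N -> (forall n, (N < n)%N -> coprime r (w n)) ->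
  exists p : Theta -> Theta, fold_covering r p.
Proof.
move=> hr hN; have [p pE] := solenoid_pow r; exists p.
have r0 : 0 < r%:R :> R by rewrite ltr0n.
apply: open_fold_covering.
- exact: hausdorff_solenoid.
- move=> x A /(nbhs_solenoid hw)[n nA]; rewrite nbhs_filterE /=.
  have e0 : 0 < radius R w n / r%:R by rewrite divr_gt0 // radius_gt0.
  apply: filterS (nbhs_cnear n x e0) => y /(cnear_exp hr).
  by rewrite mulrC divfK ?lt0r_neq0 // -!pE => /nA.
- exact: (root_open hr hN pE).
- exact: (root_fiber hr hN pE).
Qed.

End PowerCovering.

(** * Numberings of the sheets *)

Section Labels.
Variables (r : nat) (X Y : topologicalType) (p : X -> Y).

(* [l] numbers the sheets over [U]; outside of [p @^-1` U] it is arbitrary. *)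
Definition labelling (U : set Y) (l : X -> 'I_r) :=
  (forall a, U (p a) -> \forall b \near a, l b = l a) /\
  (forall a b, U (p a) -> p a = p b -> l a = l b -> a = b).

Lemma labelling_sub U V l : U `<=` V -> labelling V l -> labelling U l.
Proof.
by move=> UV [l1 l2]; split=> [a /UV/l1//|a b /UV]; exact: l2.
Qed.

Lemma labelling_perm U l (s : {perm 'I_r}) :
  labelling U l -> labelling U (fun a => s (l a)).
Proof.
move=> [l1 l2]; split=> [a /l1|a b Ua pab /perm_inj]; last exact: l2.
by apply: filterS => b ->.
Qed.

Hypothesis pcov : fold_covering r p.

Lemma covering_open a A : nbhs a A -> nbhs (p a) (p @` A).
Proof.
move=> aA; have [[_ /(_ (p a))[U [oU Ua [F [_ _ FU FV]]]]] _] := pcov.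
have [V VF Va] : (\bigcup_(V in F) V) a by rewrite -FU.
have [h [hE [_ [g [hK gK gc]]]]] := FV V VF.
pose a' : V := SigSub (mem_set Va).
have : nbhs (g (h a')) ((\val : V -> X) @^-1` A).
  by rewrite hK; apply/nbhs_subtype; exists A.
move=> /gc; rewrite nbhs_filterE /= => /nbhs_subtype[B]; rewrite hE /= => Bpa Bg.
have nU : nbhs (p a) U by exact: open_nbhs_nbhs.
apply: filterS2 Bpa nU => u Bu Uu.
pose u' : U := SigSub (mem_set Uu).
by exists (\val (g u')); [exact: (Bg u')|rewrite -hE gK].
Qed.

Lemma labelling_surj U l y (i : 'I_r) : labelling U l -> U y ->
  exists2 a, p a = y & l a = i.
Proof.
move=> [_ linj] Uy; have [c cinj cy] := fiber_enum (pcov.2 y).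
have pc j : p (c j) = y by apply/cy; exists j.
have lc : injective (l \o c).
  by move=> j k ljk; apply/cinj/linj => //; rewrite !pc.
by have [s sK Ks] := injF_bij lc; exists (c (s i)) => //; exact: Ks.
Qed.

(** The permutation is read off on the fiber of [y]. Both labels are constant near each point of
    that fiber, and since [p] is open the finitely many such neighbourhoods cover the labels over a
    neighbourhood of [y]. *)
Lemma labelling_trans U V l l' y : labelling U l -> labelling V l' ->
  nbhs y U -> V y -> exists s : {perm 'I_r},
    \forall z \near y, forall a, p a = z -> l' a = s (l a).
Proof.
move=> lU lV yU Vy; have Uy := nbhs_singleton yU.
have h i : exists a, p a = y /\ l a = i.
  by have [a] := labelling_surj i lU Uy; exists a.
have [c cP] := choice h.
have cinj : injective (l' \o c).
  move=> i j lij; have [pi <-] := cP i; have [pj <-] := cP j.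
  by congr l; apply: lV.2 lij; rewrite pi ?pj.
exists (perm cinj).
have : \forall z \near y, forall i, (p @` [set b | l b = i /\ l' b = l' (c i)]) z.
  apply: filter_forall => i; have [pi li] := cP i.
  have Upc : U (p (c i)) by rewrite pi.
  have Vpc : V (p (c i)) by rewrite pi.
  rewrite -pi; apply: covering_open; apply: filterS2 (lU.1 _ Upc) (lV.1 _ Vpc).
  by move=> b; rewrite li.
apply: filterS2 yU => z Uz zl a pa; have [b [lb l'b] pb] := zl (l a).
by rewrite permE /= -l'b; congr l'; apply: lU.2; rewrite ?pa ?pb.
Qed.

Lemma covering_labelling y : (1 <= r)%N ->
  exists U l, [/\ open U, U y & labelling U l].
Proof.
move=> hr; have [[_ /(_ y)[U [oU Uy [F [oF tF FU FV]]]]] _] := pcov.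
have [c cinj cy] := fiber_enum (pcov.2 y).
have Vinj V a b : F V -> V a -> V b -> p a = p b -> a = b.
  move=> VF Va Vb pab; have [h [hE [_ [g [hK _ _]]]]] := FV V VF.
  have : h (SigSub (mem_set Va)) = h (SigSub (mem_set Vb)).
    by apply: val_inj; rewrite !hE.
  by move=> /(can_inj hK)/(congr1 \val).
have VU V a : F V -> V a -> U (p a).
  by move=> VF Va; have : (p @^-1` U) a by rewrite FU; exists V.
have Veq V V' a : F V -> F V' -> V a -> V' a -> V = V'.
  by move=> VF V'F Va V'a; apply: tF => //; exists a.
(* A point is labelled by the point over [y] lying in its sheet. Off the preimage of [U] the label
   is the default [Ordinal hr]. *)
have lP a : exists i, U (p a) -> exists V, [/\ F V, V a & V (c i)].
  have [Ua|] := pselect (U (p a)); last by exists (Ordinal hr).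
  have [V VF Va] : (\bigcup_(V in F) V) a by rewrite -FU.
  have [h [hE [_ [g [_ gK _]]]]] := FV V VF.
  have /cy[i ci] : p (\val (g (SigSub (mem_set Uy)))) = y by rewrite -hE gK.
  by exists i => _; exists V; split=> //; rewrite ci; exact: set_valP.
have [l lE] := choice lP.
exists U, l; split=> //; split=> [a Ua|a b Ua pab lab].
  have [V [VF Va Vc]] := lE a Ua.
  have nV : nbhs a V by apply: open_nbhs_nbhs; split=> //; exact: oF.
  apply: filterS nV => b Vb.
  have [V' [V'F V'b V'c]] := lE b (VU V b VF Vb).
  rewrite -(Veq V V' b) // in V'c.
  apply: cinj; apply: (Vinj V) => //.
  have /cy -> : exists i, c i = c (l b) by exists (l b).
  by apply/esym/cy; exists (l a).
have [V [VF Va Vc]] := lE a Ua.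
have [V' [V'F V'b V'c]] : exists V, [/\ F V, V b & V (c (l b))] by apply: lE; rewrite -pab.
rewrite -lab in V'c; rewrite -(Veq V V' (c (l a))) // in V'b.
exact: (Vinj V).
Qed.

End Labels.

(** * Orbits of powers of a permutation *)

Lemma porbit_iter_leq (T : finType) (s : {perm T}) (x : T) q :
  (0 < q)%N -> iter q s x = x -> (#|porbit s x| <= q)%N.
Proof.
move=> q0 sq; rewrite leqNgt; apply/negP => qx.
have := uniq_traject_porbit s x => /(nth_uniq x).
move=> /(_ 0%N q); rewrite size_traject => /(_ (leq_ltn_trans (leq0n q) qx) qx).
by rewrite !nth_traject //= ?sq ?(leq_ltn_trans _ qx) // eqxx; case: q q0 {sq qx}.
Qed.

(** Orbits of [s ^+ W] lie in orbits of [s], so [s] is an [r]-cycle. With [d] the gcd of [r] and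
    [W], the power [r / d] of [s ^+ W] is a power of [s ^+ r] and fixes [x]; its orbit thus has at
    most [r / d] points, forcing [d = 1]. *)
Lemma transitive_exp_coprime r (s : {perm 'I_r}) W x :
  (0 < W)%N -> #|porbit (s ^+ W)%g x| = r -> coprime r W.
Proof.
move=> W0 sW; have r0 : (0 < r)%N by apply: leq_ltn_trans (ltn_ord x).
have sT : #|porbit s x| = r.
  apply/eqP; rewrite eqn_leq (leq_trans (max_card _)) ?card_ord //= -[leqLHS]sW.
  apply: subset_leq_card; apply/fintype.subsetP => y /porbitP[i ->].
  by rewrite -expgM; apply/porbitP; exists (W * i)%N.
have sr : iter r s x = x by have := iter_porbit s x; rewrite sT.
have d0 : (0 < gcdn r W)%N by rewrite gcdn_gt0 r0.
have : (#|porbit (s ^+ W)%g x| <= r %/ gcdn r W)%N.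
  apply: porbit_iter_leq; first by rewrite divn_gt0 // dvdn_leq // dvdn_gcdl.
  have -> : iter (r %/ gcdn r W) (s ^+ W)%g x = iter (W %/ gcdn r W) (iter r s) x.
    rewrite -permX -expgM permX -iterM; congr (iter _ _ _).
    by rewrite mulnC !divn_mulAC ?dvdn_gcdl ?dvdn_gcdr // mulnC.
  by elim: (W %/ _)%N => //= k ->.
rewrite sW => h.
by rewrite /coprime eqn_leq d0 andbT -(leq_pmul2l r0) muln1 -leq_divRL.
Qed.

(** * Numberings over arcs *)

Lemma circle_net (R : realType) (e : R) : 0 < e -> exists K (z : 'I_K -> R[i]),
  (forall j, `|z j| = 1) /\ forall u, `|u| = 1 -> exists j, cnear e (z j) u.
Proof.
move=> e0; pose K := (Num.truncn e^-1).+1.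
have K0 : 0 < K%:R :> R by rewrite ltr0n.
have Ke : K%:R^-1 < e by rewrite invf_plt ?posrE // truncnS_gt.
(* The angles run from -1/2 to 1/2 in steps of [1 / K], both ends included. Truncation picks the net
   point just before [t]. *)
exists K.+1, (fun j => cis (j%:R / K%:R - 2^-1)); split=> [j|_ /circle_cis[t -> [+ _]]].
  exact: normr_cis.
rewrite ler_norml => /andP[t1 t2].
have tK : 0 <= (t + 2^-1) * K%:R by rewrite mulr_ge0 // -lerBlDr sub0r.
have /andP[j1 j2] := truncn_itv tK.
have jK : (Num.truncn ((t + 2^-1) * K%:R) < K.+1)%N.
  rewrite ltnS -(ler_nat R); apply: le_trans j1 _.
  by rewrite ger_pMl //; lra.
exists (Ordinal jK); set j := Num.truncn _ in j1 j2 jK *.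
pose d := t + 2^-1 - j%:R / K%:R.
have dK : d * K%:R = (t + 2^-1) * K%:R - j%:R by rewrite mulrBl divfK ?gt_eqF.
have -> : t = j%:R / K%:R - 2^-1 + d by rewrite /d; lra.
apply: cnear_cisD; apply: le_lt_trans Ke; rewrite ger0_norm.
  by rewrite -(ler_pM2r K0) mulVf ?gt_eqF // dK lerBlDr [1 + _]addrC natr1 ltW.
by rewrite -(pmulr_lge0 _ K0) dK subr_ge0.
Qed.

Section Monodromy.
Variables (R : realType) (w : nat -> nat).
Hypothesis hw : forall n, (1 <= n)%N -> (1 < w n)%N.
Local Notation Theta := (solenoid R w).
Local Notation rad := (radius R w).
Implicit Types (x y : Theta) (k m n : nat).

(** This plays the role of the Lebesgue number lemma: finitely many of the given arcs cover the
    compact solenoid, and the largest of their thresholds [m] serves everywhere. *)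
Lemma lebesgue_solenoid (P : nat -> Theta -> Prop) :
  (forall x, exists m, forall n, (m <= n)%N ->
     forall y, cnear (rad m) (pr m x) (pr m y) -> P n y) ->
  exists N, forall n, (N <= n)%N -> forall x, P n x.
Proof.
move=> hP; have /compact_near_coveringP := @compact_solenoid R w hw.
move=> /(_ nat \oo P _)[].
  move=> x _; have [m mP] := hP x.
  exists ([set y | cnear (rad m) (pr m x) (pr m y)], [set n | (m <= n)%N]).
    by split; [exact: nbhs_cnear (radius_gt0 _ hw m)|exists m].
  by move=> [y n] /= [xy mn]; exact: mP.
by move=> N _ NP; exists N => n Nn x; exact: NP.
Qed.

(** The index [m.*2.+1] is chosen because its successor is twice [m.+1], which halves the radius
    seen at coordinate [m]. Two such steps then fit in one arc of radius [rad m]. *)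
Lemma cnear_radius_half m n x y : (m.*2.+1 <= n)%N ->
  cnear (rad n) (pr n x) (pr n y) -> cnear (rad m / 2) (pr m x) (pr m y).
Proof.
move=> mn /(cnear_radius hw mn).
have m2 : (m <= m.*2.+1)%N by rewrite ltnW // ltnS -addnn leq_addr.
move=> /(cnear_pr hw m2); apply: cnear_le.
rewrite wprod_radiusE // /radius (_ : m.*2.+2 = (m.+1 * 2)%N); last by rewrite muln2.
by rewrite natrM mulrAC [X in _ <= X]mulrC -invfM mulrC.
Qed.

Lemma near_cnear e (z : R[i]) n x :
  cnear e z (pr n x) -> \forall y \near x, cnear e z (pr n y).
Proof.
move=> [s se xE]; have e0 : 0 < e - `|s| by rewrite subr_gt0.
apply: filterS (nbhs_cnear n x e0) => y [t te ->].
exists (s + t); last by rewrite cisD mulrA xE.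
by rewrite (le_lt_trans (ler_normD _ _)) // addrC -ltrBrDr.
Qed.

Variables (r : nat) (X : topologicalType) (p : X -> Theta).
Hypotheses (hr : (1 <= r)%N) (pcov : fold_covering r p).

Lemma uniform_labelling : exists n, forall x, exists l : X -> 'I_r,
  labelling p [set y | cnear (rad n) (pr n x) (pr n y)] l.
Proof.
have [|N NP] := @lebesgue_solenoid (fun n x => exists l : X -> 'I_r,
  labelling p [set y | cnear (rad n) (pr n x) (pr n y)] l).
  move=> x; have [U [l [oU Ux lU]]] := covering_labelling pcov x hr.
  have /(nbhs_solenoid hw)[m mU] := open_nbhs_nbhs (conj oU Ux).
  exists m.*2.+1 => n mn y xy; exists l; apply: labelling_sub lU => z yz.
  apply: mU; rewrite [rad m]splitr; apply: cnear_trans.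
    exact: cnear_radius_half (leqnn _) xy.
  exact: cnear_radius_half mn yz.
by exists N; exact: NP.
Qed.

(** Compactness is used twice: first to label all arcs of a fixed radius at coordinate [n1], of
    which a finite net is kept, then to make the finitely many transition permutations constant on
    arcs at a later coordinate. The numbering at [u] is that of a net point near the image of [u] at
    coordinate [n1]. *)
Lemma rigid_labelling : exists n (e : R), 0 < e /\ exists l : R[i] -> X -> 'I_r,
  (forall z, `|z| = 1 -> labelling p [set y | cnear e z (pr n y)] (l z)) /\
  forall z u, `|z| = 1 -> cnear e z u -> exists s : {perm 'I_r},
    forall a, cnear e z (pr n (p a)) -> l u a = s (l z a).
Proof.
have [n1 n1P] := uniform_labelling.
have rad0 n : 0 < rad n by exact: radius_gt0.
have four0 : 0 < 4 :> R by rewrite ltr0n.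
have [K [z [z1 zP]]] := circle_net (divr_gt0 (rad0 n1) four0).
have lP j : exists l : X -> 'I_r, labelling p [set y | cnear (rad n1) (z j) (pr n1 y)] l.
  by have [t <-] := pr_line_surj hw n1 (z1 j); exact: n1P.
have {n1P lP}[l lP] := choice lP.
(* Half the radius leaves room to move [x] to a nearby point that still lies in the full arc, where
   [labelling_trans] applies. *)
pose near2 x j := cnear (rad n1 / 2) (z j) (pr n1 x).
have [|n2 n2P] := @lebesgue_solenoid (fun n x => forall jk : 'I_K * 'I_K,
    near2 x jk.1 -> near2 x jk.2 -> exists s : {perm 'I_r},
    forall a, cnear (rad n) (pr n x) (pr n (p a)) -> l jk.2 a = s (l jk.1 a)).
  move=> x; pose near1 j := cnear (rad n1) (z j) (pr n1 x).
  have sP (jk : 'I_K * 'I_K) : exists s : {perm 'I_r}, \forall y \near x,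
      near1 jk.1 -> near1 jk.2 -> forall a, p a = y -> l jk.2 a = s (l jk.1 a).
    have [[xj xk]|nx] := pselect (near1 jk.1 /\ near1 jk.2); last first.
      by exists 1%g; apply: filterE => y xj xk; case: nx.
    have [s sP] := labelling_trans pcov (lP jk.1) (lP jk.2) (near_cnear xj) xk.
    by exists s; apply: filterS sP => y sy _ _.
  have [s {}sP] := choice sP.
  have [m mP] := (nbhs_solenoid hw _ _).1 (filter_forall _ sP).
  exists (maxn m n1).*2.+1 => n Mn y xy jk yj yk; exists (s jk) => a ya.
  have le_max k k' : (k <= k')%N -> (k.*2.+1 <= k'.*2.+1)%N by rewrite ltnS leq_double.
  have mn := leq_trans (le_max _ _ (leq_maxl m n1)) Mn.
  have xym := cnear_radius_half (le_max _ _ (leq_maxl m n1)) xy.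
  have xyn := cnear_radius_half (le_max _ _ (leq_maxr m n1)) xy.
  apply: (mP (p a) _ jk _ _ a erefl).
  - by rewrite [rad m]splitr; apply: cnear_trans xym (cnear_radius_half mn ya).
  - by rewrite /near1 [rad n1]splitr; apply: cnear_trans yj (cnear_sym xyn).
  - by rewrite /near1 [rad n1]splitr; apply: cnear_trans yk (cnear_sym xyn).
pose n := maxn n1 n2; have n1n : (n1 <= n)%N := leq_maxl _ _.
have e0 : 0 < rad n / 4 by rewrite divr_gt0.
have jP (u : R[i]) : exists j, `|u| = 1 -> cnear (rad n1 / 4) (z j) (u ^+ wprod w n1 n).
  have [u1|] := pselect (`|u| = 1); last first.
    by have [j _] := zP 1 (normr1 _); exists j.
  by have [|j] := zP (u ^+ wprod w n1 n); [rewrite normrX u1 expr1n|exists j].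
have {zP jP}[f fP] := choice jP.
(* A quarter of [rad n1] comes from the net, and another quarter from the arc about [u] carried to
   coordinate [n1]. *)
have fnear u x : `|u| = 1 -> cnear (rad n / 4) u (pr n x) -> near2 x (f u).
  move=> u1 /(cnear_exp (wprod_gt0 hw n1 n)); rewrite -pr_exp // => ux.
  have := cnear_trans (fP u u1) ux; apply: cnear_le.
  have := wprod_radius R hw n1n; lra.
exists n, (rad n / 4); split=> //; exists (fun u => l (f u)); split=> [u u1|u v u1 uv].
  apply: labelling_sub (lP (f u)) => x /(fnear u x u1).
  by apply: cnear_le; have := rad0 n1; lra.
have v1 : `|v| = 1 by case: uv => s _ ->; rewrite normrM u1 normr_cis mulr1.
have [t tu] := pr_line_surj hw n u1; set x := line hw t in tu.
have xu : near2 x (f u) by apply: fnear; rewrite ?tu //; apply: cnear_refl.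
have xv : near2 x (f v) by apply: fnear; rewrite ?tu //; apply: cnear_sym.
have [s sP] := n2P n (leq_maxr _ _) x (f u, f v) xu xv.
exists s => a ua; apply: sP; rewrite tu; apply: cnear_le ua.
by have := rad0 n; lra.
Qed.

(* [L i] numbers the sheets over the arc around [cis (i / K)]; it is continued
   along the successive arcs, so a full turn ([i] to [i + K]) yields [tau]. *)
Lemma cyclic_labelling : exists n K (L : nat -> X -> 'I_r) (tau : {perm 'I_r}),
  [/\ (0 < K)%N,
    forall i, labelling p [set y | cnear K%:R^-1 (cis (i%:R / K%:R)) (pr n y)] (L i),
    forall i a, cnear K%:R^-1 (cis (i%:R / K%:R)) (pr n (p a)) ->
      cnear K%:R^-1 (cis (i.+1%:R / K%:R)) (pr n (p a)) -> L i.+1 a = L i a &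
    forall i a, L (i + K)%N a = tau (L i a)].
Proof.
have [n [e [e0 [l [lP sP]]]]] := rigid_labelling.
pose K := (Num.truncn e^-1).+1.
have K0 : 0 < K%:R :> R by rewrite ltr0n.
have Ke : K%:R^-1 < e by rewrite invf_plt ?posrE // truncnS_gt.
pose z i : R[i] := cis (i%:R / K%:R).
have zS i : z i.+1 = z i * cis K%:R^-1.
  by rewrite /z -cisD; congr cis; rewrite -natr1 mulrDl mul1r.
have zK i : z (i + K)%N = z i.
  by rewrite /z natrD mulrDl divff ?gt_eqF // cisD cis1 mulr1.
(* The permutation is chosen as a function of the point [u] and not of an index, so along [z] it
   repeats with period [K]. *)
have shiftP (u : R[i]) : exists s : {perm 'I_r}, `|u| = 1 ->
    forall a, cnear e u (pr n (p a)) -> l (u * cis K%:R^-1) a = s (l u a).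
  have [u1|] := pselect (`|u| = 1); last by exists 1%g.
  have [|s] := sP u (u * cis K%:R^-1) u1; last by exists s.
  by exists K%:R^-1 => //; rewrite ger0_norm // invr_ge0 ltW.
have {sP shiftP}[s sP] := choice shiftP.
(* The permutation [sigma i] undoes the transitions met so far, so consecutive corrected numberings
   agree on overlaps. One period accumulates the monodromy [sigma K]. *)
pose sigma := fix sigma i : {perm 'I_r} :=
  if i is i'.+1 then ((s (z i'))^-1 * sigma i')%g else 1%g.
have sigmaK i : sigma (i + K)%N = (sigma i * sigma K)%g.
  by elim: i => [|i IHi]; rewrite ?mul1g //= zK IHi mulgA.
exists n, K, (fun i a => sigma i (l (z i) a)), (sigma K); split=> //.
- move=> i; apply: labelling_perm; apply: labelling_sub (lP (z i) (normr_cis _)) => y.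
  by apply: cnear_le; exact: ltW.
- move=> i a /(cnear_le (ltW Ke)) ia _ /=.
  by rewrite zS sP ?normr_cis // permM permK.
- by move=> i a; rewrite zK sigmaK permM.
Qed.

End Monodromy.

(** * Monodromy *)

Section Transitivity.
Variables (R : realType) (w : nat -> nat).
Hypothesis hw : forall n, (1 <= n)%N -> (1 < w n)%N.
Local Notation Theta := (solenoid R w).
Variables (r : nat) (X : topologicalType) (p : X -> Theta).
Hypotheses (hr : (1 <= r)%N) (pcov : fold_covering r p).
Variables (n K : nat) (L : nat -> X -> 'I_r) (tau : {perm 'I_r}).
Hypotheses (hK : (0 < K)%N)
  (hL : forall i, labelling p [set y | cnear K%:R^-1 (cis (i%:R / K%:R)) (pr n y)] (L i))
  (hLS : forall i a, cnear K%:R^-1 (cis (i%:R / K%:R)) (pr n (p a)) ->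
      cnear K%:R^-1 (cis (i.+1%:R / K%:R)) (pr n (p a)) -> L i.+1 a = L i a)
  (hLK : forall i a, L (i + K)%N a = tau (L i a)).
Variable m : nat.
Hypothesis nm : (n <= m)%N.
Local Notation W := (wprod w n m).

Let K0 : 0 < K%:R :> R.
Proof. by rewrite ltr0n. Qed.

Let W0 : 0 < W%:R :> R.
Proof. by rewrite ltr0n wprod_gt0. Qed.

Lemma label_domain s i a : pr m (p a) = cis s -> `|s * W%:R * K%:R - i%:R| < 1 ->
  cnear K%:R^-1 (cis (i%:R / K%:R)) (pr n (p a)).
Proof.
move=> sa si; rewrite (pr_exp _ nm) sa -cisX.
have -> : W%:R * s = i%:R / K%:R + (s * W%:R * K%:R - i%:R) / K%:R.
  by rewrite mulrBl mulfK ?gt_eqF // addrC subrK mulrC.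
apply: cnear_cisD; rewrite normrM normfV (gtr0_norm K0).
by rewrite ltr_pdivrMr // mulVf ?gt_eqF.
Qed.

(** Two indices at distance below 1 from the same real number differ by at most 1, and consecutive
    numberings agree on the overlap of their arcs. *)
Lemma label_adjacent s i j a : pr m (p a) = cis s ->
  `|s * W%:R * K%:R - i%:R| < 1 -> `|s * W%:R * K%:R - j%:R| < 1 -> L i a = L j a.
Proof.
wlog ij : i j / (i <= j)%N => [hwlog sa si sj|sa si sj].
  have [ij|/ltnW ji] := leqP i j; first exact: hwlog.
  by apply/esym/hwlog.
have : (j < i.+2)%N.
  rewrite -(ltr_nat R) -addn2 natrD.
  by move: si sj; rewrite !ltr_norml => /andP[a1 a2] /andP[b1 b2]; lra.
rewrite ltnS leq_eqVlt => /predU1P[ji|]; last first.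
  by rewrite ltnS => ji; congr (L _ a); apply/eqP; rewrite eqn_leq ij.
by rewrite ji in sj *; apply/esym/hLS; exact: label_domain sa _.
Qed.

Lemma label_shift i k a : L (i + k * K)%N a = (tau ^+ k)%g (L i a).
Proof.
elim: k => [|k IHk]; first by rewrite addn0 expg0 perm1.
by rewrite mulSnr addnA hLK IHk expgSr permM.
Qed.

Section Invariant.
Variable O : 'I_r -> Prop.
Hypothesis hO : forall i, O ((tau ^+ W)%g i) <-> O i.

Lemma invariant_pow k i : O ((tau ^+ (k * W))%g i) <-> O i.
Proof.
elim: k => [|k IHk]; first by rewrite mul0n expg0 perm1.
by rewrite mulSnr expgD permM hO.
Qed.

(** The angles differ by [k] whole turns at coordinate [m], that is by [k * W] turns at coordinate
    [n], or [k * W * K] arcs. The labels then differ by a power of [tau ^+ W], which preserves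
    [O]. *)
Lemma label_invariant s t i j a : pr m (p a) = cis s -> pr m (p a) = cis t ->
  `|s * W%:R * K%:R - i%:R| < 1 -> `|t * W%:R * K%:R - j%:R| < 1 ->
  O (L i a) -> O (L j a).
Proof.
move=> sa ta si tj; have [k] : exists k : int, t = s + k%:~R by apply: cis_eq; rewrite -sa.
have shift (l : nat) s' i' : `|s' * W%:R * K%:R - i'%:R| < 1 ->
    `|(s' + l%:R) * W%:R * K%:R - (i' + l * W * K)%N%:R| < 1 :> R.
  by rewrite natrD !natrM !mulrDl opprD addrACA subrr addr0.
case: k => k tE.
  rewrite -(@label_adjacent t (i + k * W * K)%N j) //.
    by rewrite label_shift; exact: (invariant_pow k _).2.
  by rewrite tE; exact: shift.
(* Indices of arcs are natural numbers, so negative turns are moved to the other angle. *)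
have {tE}sE : s = t + k.+1%:R by rewrite tE NegzE mulrNz subrK.
rewrite (label_adjacent sa si (j := j + k.+1 * W * K)%N).
  by rewrite label_shift; exact: (invariant_pow k.+1 _).1.
by rewrite sE; exact: shift.
Qed.

(* When the coordinate [m] has angle [s], the coordinate [n] has angle [s * W],
   hence lies in the arc of index [i] for the [i] nearest to [s * W * K]. *)
Definition label_set : set X := [set a | exists s i,
  [/\ pr m (p a) = cis s, `|s * W%:R * K%:R - i%:R| < 1 & O (L i a)]].

Lemma open_label_set : open label_set.
Proof.
rewrite openE => a [s [i [sa si Oi]]].
(* The slack left for the index [i], converted into an angle at coordinate [m]: within it the same
   [i] remains admissible. *)
pose e := (1 - `|s * W%:R * K%:R - i%:R|) / (W%:R * K%:R).
have e0 : 0 < e by rewrite divr_gt0 ?subr_gt0 // mulr_gt0.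
have near_e : \forall b \near a, cnear e (pr m (p a)) (pr m (p b)).
  exact: (pcov.1.1 a _ (nbhs_cnear m (p a) e0)).
apply: filterS2 near_e ((hL i).1 a (label_domain sa si)) => b [t te bE] Lb.
exists (s + t), i; split; [by rewrite bE sa cisD| |by rewrite Lb].
have -> : (s + t) * W%:R * K%:R - i%:R = s * W%:R * K%:R - i%:R + t * (W%:R * K%:R) by ring.
apply: le_lt_trans (ler_normD _ _) _; rewrite addrC -ltrBrDr normrM.
by rewrite (gtr0_norm (mulr_gt0 W0 K0)) -ltr_pdivlMr // mulr_gt0.
Qed.

End Invariant.

Lemma label_coordinate a : exists s i, pr m (p a) = cis s /\ `|s * W%:R * K%:R - i%:R| < 1.
Proof.
have [t ta [+ _]] := circle_cis (pr_norm m (p a)); rewrite ler_norml => /andP[t1 _].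
(* One extra turn makes the angle nonnegative, so that truncation yields a natural index. *)
have s0 : 0 <= (t + 1) * W%:R * K%:R by rewrite !mulr_ge0 //; lra.
have /andP[i1 i2] := truncn_itv s0.
exists (t + 1), (Num.truncn ((t + 1) * W%:R * K%:R)); split.
  by rewrite cisD cis1 mulr1.
by rewrite ger0_norm ?subr_ge0 // ltrBlDl natr1.
Qed.

(** By [label_invariant], the complement of the label set of [O] is the label set of the complement
    of [O]. Both are open, so connectedness makes the first everything; all labels occur over the
    point with angle 0, hence all belong to [O]. *)
Lemma label_transitive (O : 'I_r -> Prop) : connected [set: X] ->
  (forall i, O ((tau ^+ W)%g i) <-> O i) -> (exists i, O i) -> forall i, O i.
Proof.
move=> cX hO [i0 Oi0].
have hOC i : ~ O ((tau ^+ W)%g i) <-> ~ O i by rewrite hO.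
have AC : label_set (fun i => ~ O i) = ~` label_set O.
  apply/seteqP; split=> a.
    move=> [s [i [sa si nOi]]] [t [j [ta tj Oj]]]; apply: nOi.
    exact: (label_invariant hO ta sa tj si).
  have [s [i [sa si]]] := label_coordinate a.
  by move=> nA; exists s, i; split=> // Oi; apply: nA; exists s, i.
pose x := line hw (0 : R).
have xm : pr m x = cis 0 by rewrite pr_line mul0r.
have x0 : `|0 * W%:R * K%:R - 0%:R| < 1 :> R by rewrite !mul0r subr0 normr0.
have lift0 i : exists a, p a = x /\ L 0 a = i.
  have [|a] := labelling_surj pcov i (hL 0) (y := x); last by exists a.
  by rewrite /= !mul0r pr_line mul0r; apply: cnear_refl; rewrite invr_gt0.
have A_T : label_set O = setT.
  apply: cX.
  - have [a [ax La]] := lift0 i0.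
    by exists a, 0, 0%N; split; rewrite ?ax ?La.
  - by exists (label_set O); [exact: open_label_set|rewrite setTI].
  - exists (label_set O); last by rewrite setTI.
    by rewrite -[label_set O]setCK -AC; apply/open_closedC/open_label_set.
move=> i; have [a [ax La]] := lift0 i.
have [s [j [sa sj Oj]]] : label_set O a by rewrite A_T.
by rewrite -La; apply: (label_invariant hO sa _ sj x0 Oj); rewrite ax.
Qed.

Lemma label_coprime : connected [set: X] -> coprime r W.
Proof.
move=> cX; pose x := Ordinal hr; apply: (@transitive_exp_coprime _ tau _ x).
  exact: wprod_gt0.
suff h i : i \in porbit (tau ^+ W)%g x.
  have /eq_card -> : porbit (tau ^+ W)%g x =i 'I_r by move=> i; rewrite h.
  exact: card_ord.
apply: (label_transitive (O := fun i => i \in porbit (tau ^+ W)%g x) cX).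
  by move=> j; rewrite -!eq_porbit_mem -(porbit_perm _ 1 j) expg1.
by exists x; exact: porbit_id.
Qed.

End Transitivity.

(** * The equivalence *)

Lemma connected_covering_coprime (R : realType) (w : nat -> nat)
    (hw : forall n, (1 <= n)%N -> (1 < w n)%N) (r : nat) (hr : (1 <= r)%N)
    (X : topologicalType) (p : X -> solenoid R w) :
  connected [set: X] -> fold_covering r p ->
  exists N, forall n, (N < n)%N -> coprime r (w n).
Proof.
move=> cX pcov; have [n [K [L [tau [hK hL hLS hLK]]]]] := cyclic_labelling hw hr pcov.
exists n => m nm; have := label_coprime hw hr pcov hK hL hLS hLK (ltnW nm) cX.
(* For [m > n] the number [w m] is the last factor of [wprod n m]. *)
apply: coprime_dvdr; case: m nm => // m nm.
by rewrite /wprod big_nat_recr //= dvdn_mull.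
Qed.

Unset Implicit Arguments.

Theorem corollary3 (R : realType) (w : nat -> nat)
    (hw : forall n, (1 <= n)%N -> (1 < w n)%N) (r : nat) (hr : (1 <= r)%N) :
  (exists (X : topologicalType) (p : X -> solenoid R w),
      connected [set: X] /\ fold_covering r p) <->
  finite_set [set n : nat | (1 <= n)%N /\ ~ coprime r (w n)].
Proof.
split=> [[X [p [cX pcov]]]|].
  have [N hN] := connected_covering_coprime hw hr cX pcov.
  apply: (sub_finite_set _ (finite_II N.+1)) => n /= [_ nc].
  by rewrite ltnS leqNgt; apply/negP => /hN.
move=> /finite_seqP[s sE].
(* The largest exceptional index serves as the bound [N]. *)
have hN n : (\max_(i <- s) i < n)%N -> coprime r (w n).
  move=> sn; apply: contrapT => nc.
  have : n \in s.
    suff : [set` s] n by [].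
    by rewrite -sE; split=> //; apply: leq_ltn_trans sn.
  by move=> /(@leq_bigmax_seq _ s xpredT id n)/(_ isT); rewrite leqNgt sn.
have [p pcov] := solenoid_covering R hw hr hN.
by exists (solenoid R w : topologicalType), p; split=> //; exact: connected_solenoid.
Qed.
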